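(* For a variable-symmetric tensor $T$, $\omega_u(T)\ge 2\log(\tilde R(T))/\log(\tilde S(T))$.
   Context: Tensors over a field $\mathbb{F}$; a tensor over finite variable sets $X,Y,Z$ is a trilinear form $\sum\alpha_{xyz}xyz$. $T$ is variable-symmetric if $|X|=|Y|=|Z|$ and (indexing $X=\{x_i\},Y=\{y_i\},Z=\{z_i\}$ by the same index set) the coefficient of $x_iy_jz_k$ equals that of $x_jy_kz_i$ for all $i,j,k$. Tensor powers, direct sums, rank $R$ and asymptotic rank $\tilde R(T)=\liminf_nR(T^{\otimes n})^{1/n}$ are standard; $\langle a,b,c\rangle=\sum_{i\in[a],j\in[b],k\in[c]}x_{ij}y_{jk}z_{ki}$. Degeneration of $T_1$ to $T_2$: substitute each variable of $T_1$ by a linear combination of variables of $T_2$ with coefficients polynomials in a formal variable $\lambda$ so that $T_2$ is the coefficient of some $\lambda^h$ and lower powers vanish. $\omega_u(T)$: for each $n$ and each degeneration of $T^{\otimes n}$ into $\bigoplus_{i=1}^m\langle a_i,b_i,c_i\rangle$, let $w$ satisfy $\sum_i(a_ib_ic_i)^{w/3}=\tilde R(T)^n$; $\omega_u(T)$ is the infimum (liminf) of such $w$. Slice rank: $T$ has x-rank 1 if $T=(\sum\alpha_xx)\otimes(\sum\beta_{yz}yz)$, $S_x$ is the least number of such summands, similarly $S_y,S_z$; $S(T)=\min\{S_x(T_X)+S_y(T_Y)+S_z(T_Z):T=T_X+T_Y+T_Z\}$; $\tilde S(T)=\limsup_nS(T^{\otimes n})^{1/n}$.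
   Formalization: In ω_u(T), only n ≥ 1, positive a_i, b_i, c_i and sums not made solely of ⟨1,1,1⟩ are admitted; otherwise w is not determined: T = ⟨2⟩ degenerates to two copies of ⟨1,1,1⟩, every w satisfies 1+1 = 2, and the infimum would be −∞ while the bound is 2. *)

(* Defs.v *)
From HB Require Import structures.
From mathcomp Require Import all_boot all_order all_algebra.
From mathcomp Require Import all_classical all_reals all_analysis.
Set Implicit Arguments.
Unset Strict Implicit.
Unset Printing Implicit Defensive.
Import Order.TTheory GRing.Theory Num.Theory.
Local Open Scope ring_scope.

(* The trilinear form \sum_(x, y, z) T (x, y, z) x y z over the variable sets
   X, Y, Z is represented by its coefficients. *)
Definition tensor (K : Type) (X Y Z : finType) := {ffun X * Y * Z -> K}.

Section Operations.
Variable K : pzRingType.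

(* The power uses the variable sets X^n, Y^n, Z^n. *)
Definition tpow (X Y Z : finType) (T : tensor K X Y Z) (n : nat) :
    tensor K {ffun 'I_n -> X} {ffun 'I_n -> Y} {ffun 'I_n -> Z} :=
  [ffun t : {ffun 'I_n -> X} * {ffun 'I_n -> Y} * {ffun 'I_n -> Z} =>
     \prod_(i < n) T (t.1.1 i, t.1.2 i, t.2 i)].

(* The variable sets are disjoint unions, hence sigma types. The coefficient of
   x y z is 0 unless x, y, z belong to the same summand [tag x]. *)
Definition direct_sum (I : finType) (X Y Z : I -> finType)
    (T : forall i, tensor K (X i) (Y i) (Z i)) :
    tensor K {i : I & X i} {i : I & Y i} {i : I & Z i} :=
  [ffun t => let: (x, y, z) := t in
     untag 0 (fun y' : Y (tag x) =>
       untag 0 (fun z' : Z (tag x) => T (tag x) (tagged x, y', z')) z) y].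

(* <a, b, c> = \sum_(i, j, k) x_ij y_jk z_ki *)
Definition matmul_tensor (a b c : nat) :
    tensor K ('I_a * 'I_b)%type ('I_b * 'I_c)%type ('I_c * 'I_a)%type :=
  [ffun t => let: ((i, j), (j', k), (k', i')) := t in
     ((i == i') && (j == j') && (k == k'))%:R].

(* The result of substituting \sum_x2 A x1 x2 x2 for x1, and similarly for the
   variables of the other two kinds. *)
Definition substitute (X1 Y1 Z1 X2 Y2 Z2 : finType)
    (A : X1 -> X2 -> K) (B : Y1 -> Y2 -> K) (C : Z1 -> Z2 -> K)
    (T : tensor K X1 Y1 Z1) : tensor K X2 Y2 Z2 :=
  [ffun t => \sum_(s : X1 * Y1 * Z1)
     T s * A s.1.1 t.1.1 * B s.1.2 t.1.2 * C s.2 t.2].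

(* Products of linear forms, and x-, y-, z-rank 1 tensors (or 0). *)
Definition rank_one (X Y Z : finType)
    (u : X -> K) (v : Y -> K) (w : Z -> K) : tensor K X Y Z :=
  [ffun t => u t.1.1 * v t.1.2 * w t.2].

Definition slice_x (X Y Z : finType) (u : X -> K) (M : Y -> Z -> K) :
    tensor K X Y Z := [ffun t => u t.1.1 * M t.1.2 t.2].

Definition slice_y (X Y Z : finType) (v : Y -> K) (M : X -> Z -> K) :
    tensor K X Y Z := [ffun t => v t.1.2 * M t.1.1 t.2].

Definition slice_z (X Y Z : finType) (w : Z -> K) (M : X -> Y -> K) :
    tensor K X Y Z := [ffun t => w t.2 * M t.1.1 t.1.2].

End Operations.

Definition variable_symmetric (K : Type) (X Y Z : finType)
    (T : tensor K X Y Z) : Prop :=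
  exists (q : nat) (x : 'I_q -> X) (y : 'I_q -> Y) (z : 'I_q -> Z),
    [/\ bijective x, bijective y, bijective z &
        forall i j k : 'I_q, T (x i, y j, z k) = T (x j, y k, z i)].

Definition degenerates (F : fieldType) (X1 Y1 Z1 X2 Y2 Z2 : finType)
    (T1 : tensor F X1 Y1 Z1) (T2 : tensor F X2 Y2 Z2) : Prop :=
  exists (A : X1 -> X2 -> {poly F}) (B : Y1 -> Y2 -> {poly F})
         (C : Z1 -> Z2 -> {poly F}) (h : nat),
    let S := substitute A B C [ffun s => (T1 s)%:P] in
    forall t, (S t)`_h = T2 t /\ forall d, (d < h)%N -> (S t)`_d = 0.

Lemma least_subproof (P : nat -> Prop) : (exists n, P n) -> exists n, `[< P n >].
Proof. by case=> n Pn; exists n; apply/asboolP. Qed.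

Definition least (P : nat -> Prop) (exP : exists n, P n) : nat :=
  ex_minn (least_subproof exP).

Section Ranks.
Variables (F : fieldType) (X Y Z : finType).
Implicit Type T : tensor F X Y Z.

Definition has_rank T (r : nat) : Prop :=
  exists (u : 'I_r -> X -> F) (v : 'I_r -> Y -> F) (w : 'I_r -> Z -> F),
    T = \sum_(l < r) rank_one (u l) (v l) (w l).

Definition has_Sx T (r : nat) : Prop :=
  exists (u : 'I_r -> X -> F) (M : 'I_r -> Y -> Z -> F),
    T = \sum_(l < r) slice_x (u l) (M l).

Definition has_Sy T (r : nat) : Prop :=
  exists (v : 'I_r -> Y -> F) (M : 'I_r -> X -> Z -> F),
    T = \sum_(l < r) slice_y (v l) (M l).

Definition has_Sz T (r : nat) : Prop :=
  exists (w : 'I_r -> Z -> F) (M : 'I_r -> X -> Y -> F),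
    T = \sum_(l < r) slice_z (w l) (M l).

Lemma has_rank_ex T : exists r, has_rank T r.
Proof.
exists #|{: X * Y * Z}|, (fun l x => T (enum_val l) * (x == (enum_val l).1.1)%:R),
  (fun l y => (y == (enum_val l).1.2)%:R), (fun l z => (z == (enum_val l).2)%:R).
apply/ffunP => -[[x y] z]; rewrite sum_ffunE (bigD1 (enum_rank (x, y, z)))//=.
rewrite ffunE enum_rankK /= !eqxx !mulr1 big1 ?addr0// => l nl.
rewrite ffunE /= -!mulrA -!natrM !mulnb.
case: andP => [[/eqP ex /andP[/eqP ey /eqP ez]]|_]; last by rewrite mulr0.
by case/eqP: nl; apply: enum_val_inj; rewrite enum_rankK ex ey ez -!surjective_pairing.
Qed.

Lemma has_Sx_ex T : exists r, has_Sx T r.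
Proof.
exists #|X|, (fun l x => (x == enum_val l)%:R), (fun l y z => T (enum_val l, y, z)).
apply/ffunP => -[[x y] z]; rewrite sum_ffunE (bigD1 (enum_rank x))//=.
rewrite ffunE enum_rankK /= eqxx mul1r big1 ?addr0// => l nl.
rewrite ffunE /=; case: eqP => [ex|_]; last by rewrite mul0r.
by case/eqP: nl; rewrite ex enum_valK.
Qed.

Lemma has_Sy_ex T : exists r, has_Sy T r.
Proof.
exists #|Y|, (fun l y => (y == enum_val l)%:R), (fun l x z => T (x, enum_val l, z)).
apply/ffunP => -[[x y] z]; rewrite sum_ffunE (bigD1 (enum_rank y))//=.
rewrite ffunE enum_rankK /= eqxx mul1r big1 ?addr0// => l nl.
rewrite ffunE /=; case: eqP => [ey|_]; last by rewrite mul0r.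
by case/eqP: nl; rewrite ey enum_valK.
Qed.

Lemma has_Sz_ex T : exists r, has_Sz T r.
Proof.
exists #|Z|, (fun l z => (z == enum_val l)%:R), (fun l x y => T (x, y, enum_val l)).
apply/ffunP => -[[x y] z]; rewrite sum_ffunE (bigD1 (enum_rank z))//=.
rewrite ffunE enum_rankK /= eqxx mul1r big1 ?addr0// => l nl.
rewrite ffunE /=; case: eqP => [ez|_]; last by rewrite mul0r.
by case/eqP: nl; rewrite ez enum_valK.
Qed.

Definition rank T : nat := least (has_rank_ex T).
Definition Sx T : nat := least (has_Sx_ex T).
Definition Sy T : nat := least (has_Sy_ex T).
Definition Sz T : nat := least (has_Sz_ex T).

Definition has_slice_rank T (s : nat) : Prop :=
  exists TX TY TZ : tensor F X Y Z,
    T = TX + TY + TZ /\ s = (Sx TX + Sy TY + Sz TZ)%N.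

Lemma has_slice_rank_ex T : exists s, has_slice_rank T s.
Proof.
pose O : tensor F X Y Z := 0%R.
by exists (Sx T + Sy O + Sz O)%N, T, O, O; rewrite !addr0.
Qed.

Definition slice_rank T : nat := least (has_slice_rank_ex T).

End Ranks.

Section Asymptotics.
Variables (R : realType) (F : fieldType) (X Y Z : finType).
Implicit Type T : tensor F X Y Z.

(* Both sequences lie between 0 and a constant, so that the real-valued
   [limn_inf] and [limn_sup] are the actual lower and upper limits. *)
Definition asymptotic_rank T : R :=
  limn_inf (fun n => (rank (tpow T n))%:R `^ n%:R^-1).

Definition asymptotic_slice_rank T : R :=
  limn_sup (fun n => (slice_rank (tpow T n))%:R `^ n%:R^-1).

(* [w] is a bound obtained from a degeneration of some power T^n, n > 0, into a
   direct sum of matrix multiplication tensors. If all summands were <1, 1, 1>,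
   then \sum_i (a_i b_i c_i)^(w / 3) would not depend on w, and the equation
   would not define w; at least one summand must be different. *)
Definition universal_bound T (w : R) : Prop :=
  exists (n m : nat) (a b c : 'I_m -> nat),
    [/\ (0 < n)%N,
        forall i, [/\ (0 < a i)%N, (0 < b i)%N & (0 < c i)%N],
        exists i, (1 < a i * b i * c i)%N,
        degenerates (tpow T n)
          (direct_sum (fun i => matmul_tensor F (a i) (b i) (c i))) &
        \sum_(i < m) (a i * b i * c i)%:R `^ (w / 3) = asymptotic_rank T ^+ n].

(* The value is +oo when no power of T has such a degeneration. *)
Definition omega_u T : \bar R :=
  ereal_inf [set w%:E | w in universal_bound T].

End Asymptotics.

(* Main.v *)
(* Suppose T^n degenerates to the direct sum of the <a_i, b_i, c_i>, and put
   sigma = \sum_i (a_i b_i c_i)^(2/3). Then S~(T)^n >= sigma and R~(T)^n >= sigma.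
   Indeed, in the N-th power of the direct sum one of the at most (N + 1)^m type
   classes of words carries a 1/(N + 1)^m fraction of sigma^N; on it all summands
   are the same <A, B, C>. As T is invariant under rotation, multiplying by the
   two rotations gives D^3 copies of <ABC, ABC, ABC>, with D the size of the
   class. Each of them degenerates to a diagonal tensor of size about (ABC)^2/2
   (Strassen), and the slice rank of a tensor that degenerates to a diagonal one
   of size r is at least r.
   Now let \sum_i (a_i b_i c_i)^(w/3) = R~(T)^n. Some a_i b_i c_i exceeds 1, so
   w < 2 would give R~(T)^n < sigma; hence w >= 2, and superadditivity of
   x |-> x^(w/2) gives R~(T)^n <= sigma^(w/2) <= S~(T)^(n w/2). *)
Require Import Defs.
From mathcomp Require Import all_boot all_order all_algebra.
From mathcomp Require Import all_classical all_reals all_analysis.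
From mathcomp Require Import ring lra zify.
Set Implicit Arguments.
Unset Strict Implicit.
Unset Printing Implicit Defensive.
Import Order.TTheory GRing.Theory Num.Theory.
Import numFieldNormedType.Exports.
Local Open Scope ring_scope.

(** * Leading terms and orthogonal vectors over F[X] *)

Section LeadingTerm.
Variable F : fieldType.
Implicit Types (c : F) (p : {poly F}).

(** The order condition of [degenerates] for a single coefficient; [c] may be 0. *)
Definition leading_term h c p := p`_h = c /\ forall d, (d < h)%N -> p`_d = 0.

Lemma leading_termP h c p :
  leading_term h c p <-> exists q, p = 'X^h * q /\ q`_0 = c.
Proof.
split=> [[ph plt]|[q [-> q0]]].
  exists (drop_poly h p); split; last by rewrite coef_drop_poly.
  apply/polyP => i; rewrite coefXnM coef_drop_poly.
  by case: ltnP => [/plt//|hi]; rewrite subnK.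
by split=> [|d dh]; rewrite coefXnM ?ltnn ?subnn // dh.
Qed.

Lemma leading_term0 p : leading_term 0 p`_0 p.
Proof. by []. Qed.

Lemma leading_term_eq h c d p : c = d -> leading_term h c p -> leading_term h d p.
Proof. by move->. Qed.

Lemma leading_termM h h' c c' p p' : leading_term h c p ->
  leading_term h' c' p' -> leading_term (h + h') (c * c') (p * p').
Proof.
move=> /leading_termP[q [-> <-]] /leading_termP[q' [-> <-]].
apply/leading_termP; exists (q * q'); split; last by rewrite coef0M.
by rewrite exprD mulrACA.
Qed.

Lemma leading_term_sum (I : finType) h (c : I -> F) (p : I -> {poly F}) :
  (forall i, leading_term h (c i) (p i)) ->
  leading_term h (\sum_i c i) (\sum_i p i).
Proof.
move=> cp; split=> [|d dh]; rewrite coef_sum.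
  by apply: eq_bigr => i _; case: (cp i).
by rewrite big1 // => i _; case: (cp i) => _ ->.
Qed.

Lemma leading_termXn n : leading_term n 1 ('X^n : {poly F}).
Proof. by split=> [|d dn]; rewrite coefXn ?eqxx // (ltn_eqF dn). Qed.

Lemma leading_term_lt h h' c p :
  leading_term h c p -> (h' < h)%N -> leading_term h' 0 p.
Proof. by move=> [_ p0] h'h; split=> [|d dh]; rewrite p0 // (ltn_trans dh). Qed.

(** Replacing X by X^k turns a difference of one order into a difference of k, which in Strassen's
    degeneration outweighs the least total weight. *)
Lemma leading_term_comp_Xn k h c p : (0 < k)%N ->
  leading_term h c p -> leading_term (h * k) c (p \Po 'X^k).
Proof.
move=> k0 /leading_termP[q [-> <-]]; apply/leading_termP.
exists (q \Po 'X^k); rewrite rmorphM /= comp_Xn_poly -exprM mulnC; split=> //.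
by rewrite -!horner_coef0 horner_comp hornerXn expr0n (gtn_eqF k0).
Qed.

End LeadingTerm.

Section Orthogonal.
Variables (F : fieldType) (E : finType).

(* Each new vector is handled by eliminating the coordinate on which it has the
   smallest valuation, so that no denominator appears. *)
Lemma orthogonal_family k (u : nat -> E -> {poly F}) :
  exists (J : {set E}) (v : E -> E -> {poly F}),
  [/\ (#|E| <= #|J| + k)%N,
      forall j l, j \in J -> (l < k)%N -> \sum_e v j e * u l e = 0,
      forall j, j \in J -> (v j j)`_0 != 0 &
      forall i j, i \in J -> j \in J -> i != j -> (v i j)`_0 = 0].
Proof.
elim: k => [|k [J [v [cJ vu vjj vij]]]].
  exists [set: E]%SET, (fun i j => (i == j)%:R); split=> [|//|j _|i j _ _ ij].
  - by rewrite cardsT addn0.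
  - by rewrite eqxx coef1 oner_neq0.
  - by rewrite (negbTE ij) coef0.
pose c j := \sum_e v j e * u k e.
have [c0|] := boolP [forall j in J, c j == 0].
  exists J, v; split=> // [|j l Jj]; first by rewrite addnS ltnW.
  rewrite ltnS leq_eqVlt => /orP[/eqP ->|/(vu _ _ Jj)//].
  by apply/eqP; move/forall_inP: c0; apply.
rewrite negb_forall_in => /exists_inP[j1 Jj1 cj1].
(* [m] is the least order occurring among the [c j], so X^m divides them all and the quotient for
   [j0] has a nonzero constant term. *)
have /ex_minnP[m /exists_inP[j0 Jj0 cj0] mmin] :
    exists m, [exists j in J, (c j)`_m != 0].
  exists (size (c j1)).-1; apply/exists_inP; exists j1 => //.
  by rewrite -[_`_ _]/(lead_coef _) lead_coef_eq0.
pose d j := drop_poly m (c j).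
have cd j : j \in J -> c j = 'X^m * d j.
  move=> Jj; apply/polyP => i; rewrite coefXnM coef_drop_poly.
  case: ltnP => [im|/subnK ->//]; apply/eqP/negPn/negP => ci.
  have /mmin : [exists j in J, (c j)`_i != 0] by apply/exists_inP; exists j.
  by rewrite leqNgt im.
(* Orthogonality to [u k] holds because d_j0 c_j = d_j c_j0. On the remaining coordinates of [J] the
   subtracted term vanishes modulo X. *)
exists (J :\ j0), (fun j e => d j0 * v j e - d j * v j0 e).
have d0 : (d j0)`_0 != 0 by rewrite coef_drop_poly.
split=> [|j l|j|i j].
- by rewrite (leq_trans cJ) // (cardsD1 j0 J) Jj0 addnS addSn.
- rewrite !inE => /andP[jj0 Jj] lk.
  under eq_bigr do rewrite mulrBl -!mulrA.
  rewrite sumrB -!mulr_sumr; move: lk; rewrite ltnS leq_eqVlt => /orP[/eqP ->|lk].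
    by rewrite -!/(c _) !cd //; ring.
  by rewrite !vu // !mulr0 subrr.
- rewrite !inE eq_sym => /andP[j0j Jj].
  by rewrite coefB !coef0M (vij j0) // mulr0 subr0 mulf_neq0 // vjj.
- rewrite !inE => /andP[ij0 Ji] /andP[jj0 Jj] ij.
  by rewrite coefB !coef0M (vij i) // (vij j0 j) 1?[j0 == j]eq_sym // !mulr0 subr0.
Qed.

(** Modulo X the family of [orthogonal_family] is diagonal on [J], so the sum of its members has a
    nonzero constant term at every coordinate in [J]. *)
Lemma orthogonal_vector k (u : 'I_k -> E -> {poly F}) :
  exists (J : {set E}) (v : E -> {poly F}),
  [/\ (#|E| <= #|J| + k)%N, forall l, \sum_e v e * u l e = 0 &
      forall j, j \in J -> (v j)`_0 != 0].
Proof.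
pose u' l e := if insub l is Some l' then u l' e else 0.
have [J [v [cJ vu vjj vij]]] := orthogonal_family k u'.
exists J, (fun e => \sum_(j in J) v j e); split=> // [l|j Jj].
  under eq_bigr do rewrite mulr_suml.
  rewrite exchange_big big1 //= => j Jj; rewrite -[RHS](vu j l) //.
  by apply: eq_bigr => e _; rewrite /u' valK.
rewrite coef_sum (bigD1 j) //= big1 ?addr0 ?vjj// => i /andP[Ji ij].
exact: vij.
Qed.

End Orthogonal.

Lemma det_mulmx_small (K : fieldType) n k (A : 'M[K]_(n, k)) (B : 'M[K]_(k, n)) :
  (k < n)%N -> \det (A *m B) = 0.
Proof.
move=> kn; apply/eqP/negPn/negP => dAB.
have : \rank (A *m B) = n by apply/mxrank_unit; rewrite unitmxE unitfE.
by have := mulmx_max_rank A B; lia.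
Qed.

(** Divided by X^h, the minor on [J] becomes an invertible diagonal matrix at X = 0, so its
    determinant is nonzero; a factorization through fewer than #|J| columns would make it vanish. *)
Lemma leq_card_leading_diag (F : fieldType) (E : finType) (J : {set E}) h k
    (N : E -> E -> {poly F}) (d : E -> F)
    (P : E -> 'I_k -> {poly F}) (Q : 'I_k -> E -> {poly F}) :
  (forall i j, leading_term h (if i == j then d i else 0) (N i j)) ->
  (forall i, i \in J -> d i != 0) ->
  (forall i j, N i j = \sum_l P i l * Q l j) ->
  (#|J| <= k)%N.
Proof.
move=> Nd d0 NPQ; rewrite leqNgt; apply/negP => kJ.
pose M := \matrix_(i < #|J|, j < #|J|) N (enum_val i) (enum_val j).
pose M' := \matrix_(i < #|J|, j < #|J|) drop_poly h (N (enum_val i) (enum_val j)).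
have MM' : M = 'X^h *: M'.
  apply/matrixP => i j; rewrite !mxE; apply/polyP => m.
  rewrite coefXnM coef_drop_poly.
  by case: ltnP => [|/subnK->//]; case: (Nd (enum_val i) (enum_val j)) => _; apply.
have M0 : \det M = 0.
  apply/eqP; rewrite -tofrac_eq -(det_map_mx (@tofrac {poly F})); apply/eqP.
  pose MP := \matrix_(i < #|J|, l < k) P (enum_val i) l.
  pose MQ := \matrix_(l < k, j < #|J|) Q l (enum_val j).
  have -> : M = MP *m MQ.
    by apply/matrixP => i j; rewrite !mxE NPQ; apply: eq_bigr => l _; rewrite !mxE.
  by rewrite map_mxM det_mulmx_small // tofrac0.
move/eqP: M0; rewrite MM' detZ mulf_eq0 expf_eq0 expf_eq0 polyX_eq0 !andbF /=.
apply/negP; apply/eqP => /(congr1 (horner_eval 0)).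
rewrite -det_map_mx /=.
have -> : map_mx (horner_eval 0) M' = diag_mx (\row_i d (enum_val i)).
  apply/matrixP => i j; rewrite !mxE /horner_eval horner_coef0 coef_drop_poly.
  case: (Nd (enum_val i) (enum_val j)) => -> _.
  by rewrite (inj_eq enum_val_inj) mulrb.
rewrite det_diag /horner_eval horner0 => /eqP; rewrite prodf_seq_eq0.
by move=> /hasP[i _] /=; rewrite mxE (negbTE (d0 _ (enum_valP i))).
Qed.

(** * Lower bounds on the slice rank *)

Lemma leastP (P : nat -> Prop) (exP : exists n, P n) : P (least exP).
Proof. by rewrite /least; case: ex_minnP => n /asboolP. Qed.

Lemma least_le (P : nat -> Prop) (exP : exists n, P n) n :
  P n -> (least exP <= n)%N.
Proof. by move=> Pn; rewrite /least; case: ex_minnP => m _; apply; apply/asboolP. Qed.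

Lemma sum_tripleE (V : nmodType) (X Y Z : finType) (f : X * Y * Z -> V) :
  \sum_s f s = \sum_x \sum_y \sum_z f (x, y, z).
Proof. by rewrite pair_bigA pair_bigA; apply: eq_bigr => -[[]]. Qed.

Section Contraction.
Variables (F : fieldType) (X Y Z : finType).
Implicit Types (T : tensor F X Y Z) (a : X -> {poly F}) (b : Y -> {poly F})
  (c : Z -> {poly F}).

Definition trilin T a b c : {poly F} :=
  \sum_s (T s)%:P * a s.1.1 * b s.1.2 * c s.2.

Lemma trilinD T T' a b c :
  trilin (T + T') a b c = trilin T a b c + trilin T' a b c.
Proof.
by rewrite -big_split; apply: eq_bigr => s _; rewrite ffunE polyCD !mulrDl.
Qed.

Lemma trilin_sum (I : finType) (T : I -> tensor F X Y Z) a b c :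
  trilin (\sum_i T i) a b c = \sum_i trilin (T i) a b c.
Proof.
rewrite exchange_big; apply: eq_bigr => s _.
by rewrite sum_ffunE rmorph_sum !mulr_suml.
Qed.

Lemma trilin_suml (I : finType) T (v : I -> {poly F}) (a : I -> X -> {poly F})
    b c :
  trilin T (fun x => \sum_i v i * a i x) b c = \sum_i v i * trilin T (a i) b c.
Proof.
under [RHS]eq_bigr do rewrite mulr_sumr.
rewrite exchange_big; apply: eq_bigr => s _.
rewrite mulr_sumr !mulr_suml; apply: eq_bigr => i _; ring.
Qed.

Lemma trilin_slice_x u (M : Y -> Z -> F) a b c :
  trilin (slice_x u M) a b c =
  (\sum_x a x * (u x)%:P) * \sum_y \sum_z (M y z)%:P * b y * c z.
Proof.
rewrite /trilin sum_tripleE mulr_suml; apply: eq_bigr => x _.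
rewrite mulr_sumr; apply: eq_bigr => y _; rewrite mulr_sumr.
by apply: eq_bigr => z _; rewrite ffunE /= polyCM; ring.
Qed.

Lemma trilin_slice_y v (M : X -> Z -> F) a b c :
  trilin (slice_y v M) a b c =
  (\sum_y b y * (v y)%:P) * \sum_x \sum_z (M x z)%:P * a x * c z.
Proof.
rewrite /trilin sum_tripleE exchange_big mulr_suml; apply: eq_bigr => y _.
rewrite mulr_sumr; apply: eq_bigr => x _; rewrite mulr_sumr.
by apply: eq_bigr => z _; rewrite ffunE /= polyCM; ring.
Qed.

Lemma trilin_slice_z w (M : X -> Y -> F) a b c :
  trilin (slice_z w M) a b c =
  (\sum_x \sum_y (M x y)%:P * a x * b y) * \sum_z c z * (w z)%:P.
Proof.
rewrite /trilin sum_tripleE mulr_suml; apply: eq_bigr => x _.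
rewrite mulr_suml; apply: eq_bigr => y _; rewrite mulr_sumr.
by apply: eq_bigr => z _; rewrite ffunE /= polyCM; ring.
Qed.

(* Contracting with a vector orthogonal to all x-slices leaves a matrix of rank
   at most S_y + S_z, whose leading term is diagonal. *)
Lemma slice_rank_ge T (E : finType) (a : E -> X -> {poly F})
    (b : E -> Y -> {poly F}) (c : E -> Z -> {poly F}) h :
  (forall e1 e2 e3, leading_term h ((e1 == e2) && (e2 == e3))%:R
     (trilin T (a e1) (b e2) (c e3))) ->
  (#|E| <= slice_rank T)%N.
Proof.
move=> Tabc; rewrite /slice_rank.
have [TX [TY [TZ [TE ->]]]] := leastP (has_slice_rank_ex T).
have [u [MX TXE]] : has_Sx TX (Sx TX) := leastP _.
have [v [MY TYE]] : has_Sy TY (Sy TY) := leastP _.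
have [w [MZ TZE]] : has_Sz TZ (Sz TZ) := leastP _.
have [J [g [cJ gu g0]]] :=
  orthogonal_vector (fun l e => \sum_x a e x * (u l x)%:P).
pose a' x := \sum_e g e * a e x.
suff: (#|J| <= Sy TY + Sz TZ)%N by lia.
have TX0 e2 e3 : trilin TX a' (b e2) (c e3) = 0.
  rewrite TXE trilin_sum big1 // => l _; rewrite trilin_slice_x.
  suff -> : \sum_x a' x * (u l x)%:P = 0 by rewrite mul0r.
  rewrite -[RHS](gu l) /a'; under eq_bigr do rewrite mulr_suml.
  rewrite exchange_big; apply: eq_bigr => e _; rewrite mulr_sumr.
  by apply: eq_bigr => x _; rewrite mulrA.
(* After contraction every y-slice or z-slice is a function of [e2] times a function of [e3]; the
   first [Sy TY] columns come from [TY], the others from [TZ]. *)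
apply: (@leq_card_leading_diag F E J h (Sy TY + Sz TZ)
  (fun e2 e3 => trilin T a' (b e2) (c e3)) (fun e => (g e)`_0)
  (fun e2 l => match fintype.split l with
     | inl l => \sum_y b e2 y * (v l y)%:P
     | inr l => \sum_x \sum_y (MZ l x y)%:P * a' x * b e2 y end)
  (fun l e3 => match fintype.split l with
     | inl l => \sum_x \sum_z (MY l x z)%:P * a' x * c e3 z
     | inr l => \sum_z c e3 z * (w l z)%:P end)) => [e2 e3||e2 e3].
- have -> : (if e2 == e3 then (g e2)`_0 else 0) =
      \sum_e (g e)`_0 * ((e == e2) && (e2 == e3))%:R.
    rewrite (bigD1 e2) //= eqxx /= big1 ?addr0 => [|e /negbTE ->].
      by case: eqP; rewrite ?mulr1 ?mulr0.
    by rewrite mulr0.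
  rewrite trilin_suml; apply: leading_term_sum => e.
  exact: leading_termM (leading_term0 _) (Tabc _ _ _).
- exact: g0.
- rewrite {1}TE !trilinD TX0 add0r big_split_ord /=; congr (_ + _).
    rewrite {1}TYE trilin_sum; apply: eq_bigr => l _.
    by rewrite trilin_slice_y (unsplitK (inl l)).
  rewrite {1}TZE trilin_sum; apply: eq_bigr => l _.
  by rewrite trilin_slice_z (unsplitK (inr l)).
Qed.

(** A product of linear forms is an x-slice. Lower bounds on the slice rank thereby carry over to
    the asymptotic rank. *)
Lemma slice_rank_le_rank T : (slice_rank T <= rank T)%N.
Proof.
apply: (@leq_trans (Sx T + Sy (0 : tensor F X Y Z) + Sz (0 : tensor F X Y Z))).
  by apply: least_le; exists T, 0, 0; rewrite !addr0.
have -> : Sy (0 : tensor F X Y Z) = 0%N.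
  apply/eqP; rewrite -leqn0; apply: least_le.
  by exists (fun _ _ => 0), (fun _ _ _ => 0); rewrite big_ord0.
have -> : Sz (0 : tensor F X Y Z) = 0%N.
  apply/eqP; rewrite -leqn0; apply: least_le.
  by exists (fun _ _ => 0), (fun _ _ _ => 0); rewrite big_ord0.
rewrite !addn0; apply: least_le.
have [u [v [w TE]]] := leastP (has_rank_ex T).
exists u, (fun l y z => v l y * w l z); rewrite {1}TE.
by apply: eq_bigr => l _; apply/ffunP => s; rewrite !ffunE mulrA.
Qed.

(** One term per monomial; this crude bound keeps the sequences of n-th roots bounded. *)
Lemma rank_le_card T : (rank T <= #|X| * #|Y| * #|Z|)%N.
Proof.
rewrite -!card_prod; apply: least_le.
exists (fun l x => T (enum_val l) * (x == (enum_val l).1.1)%:R),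
  (fun l y => (y == (enum_val l).1.2)%:R), (fun l z => (z == (enum_val l).2)%:R).
apply/ffunP => t; rewrite sum_ffunE (reindex enum_rank) /=; last first.
  exact/onW_bij/enum_rank_bij.
under eq_bigr => s _.
  rewrite ffunE enum_rankK -!mulrA -!natrM !mulnb andbA -!xpair_eqE.
  rewrite -!surjective_pairing.
over.
by rewrite (bigD1 t) //= eqxx mulr1 big1 ?addr0 // => s; rewrite eq_sym => /negbTE ->;
  rewrite mulr0.
Qed.

End Contraction.

(** * Degenerations to sums of matrix multiplication tensors *)

Lemma untag_Tagged (I : eqType) (T_ : I -> Type) (U : Type) (idx : U) i
    (f : T_ i -> U) (x : T_ i) : untag idx f (Tagged T_ x) = f x.
Proof. exact: (untagE idx f (erefl : tag (Tagged T_ x) = i)). Qed.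

Section MatrixMultiplication.
Variables (F : fieldType) (X Y Z : finType).
Implicit Types (T : tensor F X Y Z).

(* Degeneration of T into the direct sum of the <a l, b l, c l>. The variables
   of the l-th summand are indexed by pairs of natural numbers, and only those
   within bounds matter: this avoids index types depending on l. *)
Definition mm_degenerates T (I : finType) (a b c : I -> nat) : Prop :=
  exists (A : I -> nat -> nat -> X -> {poly F})
         (B : I -> nat -> nat -> Y -> {poly F})
         (C : I -> nat -> nat -> Z -> {poly F}) (h : nat),
  forall l1 l2 l3 i1 j1 j2 k2 k3 i3,
    (i1 < a l1)%N -> (j1 < b l1)%N -> (j2 < b l2)%N -> (k2 < c l2)%N ->
    (k3 < c l3)%N -> (i3 < a l3)%N ->
    leading_term h [&& l1 == l2, l2 == l3, i1 == i3, j1 == j2 & k2 == k3]%:R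
      (trilin T (A l1 i1 j1) (B l2 j2 k2) (C l3 k3 i3)).

Lemma degenerates_mm T (I : finType) (a b c : I -> nat) :
  degenerates T (direct_sum (fun l => matmul_tensor F (a l) (b l) (c l))) ->
  mm_degenerates T a b c.
Proof.
move=> [A [B [C [h ABC]]]].
(* Out of range the value is 0, a default never met under the bounds in [mm_degenerates]. *)
pose var (V : finType) (d e : I -> nat)
    (D : V -> {l : I & 'I_(d l) * 'I_(e l)}%type -> {poly F})
    (l : I) i j v :=
  if insub i is Some i' then if insub j is Some j' then
    D v (existT _ l (i', j')) else 0 else 0 : {poly F}.
exists (var X a b A), (var Y b c B), (var Z c a C), h.
move=> l1 l2 l3 i1 j1 j2 k2 k3 i3 i1a j1b j2b k2c k3c i3a.
rewrite /var !insubT /=.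
set x := existT _ l1 _; set y := existT _ l2 _; set z := existT _ l3 _.
move: (ABC (x, y, z)).
set S := substitute _ _ _ _ _; set S' := trilin _ _ _ _ => -[S0 Slt].
have <- : S = S' by rewrite /S ffunE; apply: eq_bigr => s _; rewrite ffunE.
split=> // {Slt}; rewrite {}S0 /direct_sum ffunE /x /y /z {S S' x y z}.
case: (eqVneq l1 l2) => [l12|l12]; last by rewrite untag_dflt // eq_sym.
subst l2; rewrite untag_Tagged.
case: (eqVneq l1 l3) => [l13|l13]; last by rewrite untag_dflt // eq_sym.
by subst l3; rewrite untag_Tagged /= ffunE /= -!val_eqE /= andbA.
Qed.

Lemma mm_degenerates_inj T (I J : finType) (f : J -> I) (a b c : I -> nat) :
  injective f -> mm_degenerates T a b c ->
  mm_degenerates T (a \o f) (b \o f) (c \o f).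
Proof.
move=> f_inj [A [B [C [h ABC]]]].
exists (A \o f), (B \o f), (C \o f), h => l1 l2 l3 *.
by rewrite -!(inj_eq f_inj); apply: ABC.
Qed.

Lemma eq_mm_degenerates T (I : finType) (a b c a' b' c' : I -> nat) :
  a =1 a' -> b =1 b' -> c =1 c' ->
  mm_degenerates T a b c -> mm_degenerates T a' b' c'.
Proof. by move=> /funext-> /funext-> /funext->. Qed.

(** Bijections between the variable sets replace the common index set, so that the symmetry passes
    to powers coordinatewise. *)
Definition rotation_symmetric T : Prop :=
  exists (f : Y -> X) (g : Z -> Y) (h : X -> Z),
  [/\ bijective f, bijective g, bijective h &
      forall x y z, T (x, y, z) = T (f y, g z, h x)].

Lemma variable_symmetric_rotation T :
  variable_symmetric T -> rotation_symmetric T.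
Proof.
move=> [q [x [y [z [[x' x'K xK] [y' y'K yK] [z' z'K zK] Tsym]]]]].
exists (x \o y'), (y \o z'), (z \o x'); split.
- by apply: bij_comp; [exists x'|exists y].
- by apply: bij_comp; [exists y'|exists z].
- by apply: bij_comp; [exists z'|exists x].
- by move=> u v w /=; rewrite -Tsym xK yK zK.
Qed.

(** Transporting the substitutions along the inverse bijections rotates the three kinds of variables
    and leaves the value of the form unchanged. *)
Lemma mm_degenerates_rotate T (I : finType) (a b c : I -> nat) :
  rotation_symmetric T -> mm_degenerates T a b c -> mm_degenerates T b c a.
Proof.
move=> [f [g [h [[f' fK f'K] [g' gK g'K] [h' hK h'K] Tsym]]]].
move=> [A [B [C [m ABC]]]].
exists (fun l i j => B l i j \o f'), (fun l i j => C l i j \o g').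
exists (fun l i j => A l i j \o h'), m.
move=> l1 l2 l3 j1 k1 k2 i2 i3 j3 j1b k1c k2c i2a i3a j3b.
have -> : trilin T (B l1 j1 k1 \o f') (C l2 k2 i2 \o g') (A l3 i3 j3 \o h') =
    trilin T (A l3 i3 j3) (B l1 j1 k1) (C l2 k2 i2).
  rewrite /trilin (reindex (fun s : X * Y * Z => (f s.1.2, g s.2, h s.1.1))) /=.
    by apply: eq_bigr => -[[x y] z] _; rewrite /= fK gK hK -Tsym; ring.
  exists (fun s : X * Y * Z => (h' s.2, f' s.1.1, g' s.1.2)) => -[[x y] z] _ /=.
    by rewrite fK gK hK.
  by rewrite f'K g'K h'K.
apply: leading_term_eq (ABC l3 l1 l2 _ _ _ _ _ _ i3a j3b j1b k1c k2c i2a).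
congr (_%:R); congr nat_of_bool.
by apply/idP/idP => /and5P[/eqP-> /eqP-> /eqP-> /eqP-> /eqP->]; rewrite !eqxx.
Qed.

End MatrixMultiplication.

(** * Tensor powers: symmetry and products of degenerations *)

Section Powers.
Variables (F : fieldType) (X Y Z : finType).
Implicit Types (T : tensor F X Y Z).

Lemma bijective_ffun_comp n (U V : finType) (f : U -> V) : bijective f ->
  bijective (fun u : {ffun 'I_n -> U} => [ffun i => f (u i)]).
Proof.
move=> [g fK gK]; exists (fun v : {ffun 'I_n -> V} => [ffun i => g (v i)]) => u;
  by apply/ffunP => i; rewrite !ffunE.
Qed.

Lemma rotation_symmetric_tpow T n :
  rotation_symmetric T -> rotation_symmetric (tpow T n).
Proof.
move=> [f [g [h [fb gb hb Tsym]]]].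
exists (fun y : {ffun 'I_n -> Y} => [ffun i => f (y i)]).
exists (fun z : {ffun 'I_n -> Z} => [ffun i => g (z i)]).
exists (fun x : {ffun 'I_n -> X} => [ffun i => h (x i)]).
split; [exact: bijective_ffun_comp|exact: bijective_ffun_comp
  |exact: bijective_ffun_comp|move=> x y z].
by rewrite !ffunE; apply: eq_bigr => i _; rewrite /= !ffunE.
Qed.

Definition ffun_left m n (U : finType) (u : {ffun 'I_(m + n) -> U}) :=
  [ffun i => u (lshift n i)].
Definition ffun_right m n (U : finType) (u : {ffun 'I_(m + n) -> U}) :=
  [ffun i => u (rshift m i)].
Definition ffun_cat m n (U : finType) (u : {ffun 'I_m -> U}) (v : {ffun 'I_n -> U}) :=
  [ffun i => match fintype.split i with inl j => u j | inr j => v j end].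

Lemma ffun_catKl m n U u v : ffun_left (@ffun_cat m n U u v) = u.
Proof. by apply/ffunP => i; rewrite !ffunE (unsplitK (inl i)). Qed.

Lemma ffun_catKr m n U u v : ffun_right (@ffun_cat m n U u v) = v.
Proof. by apply/ffunP => i; rewrite !ffunE (unsplitK (inr i)). Qed.

Lemma ffun_catK m n (U : finType) (u : {ffun 'I_(m + n) -> U}) :
  ffun_cat (ffun_left u) (ffun_right u) = u.
Proof. by apply/ffunP => i; rewrite !ffunE; case: split_ordP => j ->; rewrite ffunE. Qed.

Lemma trilin_tpowD T m n a b c a' b' c' :
  trilin (tpow T (m + n)) (fun x => a (ffun_left x) * a' (ffun_right x))
    (fun y => b (ffun_left y) * b' (ffun_right y))
    (fun z => c (ffun_left z) * c' (ffun_right z)) =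
  trilin (tpow T m) a b c * trilin (tpow T n) a' b' c'.
Proof.
rewrite /trilin big_distrlr /= pair_bigA /=.
rewrite (reindex (fun p : ({ffun 'I_m -> X} * {ffun 'I_m -> Y} * {ffun 'I_m -> Z}) *
    ({ffun 'I_n -> X} * {ffun 'I_n -> Y} * {ffun 'I_n -> Z}) =>
  (ffun_cat p.1.1.1 p.2.1.1, ffun_cat p.1.1.2 p.2.1.2, ffun_cat p.1.2 p.2.2))) /=.
  apply: eq_bigr => -[[[x y] z] [[x' y'] z']] _ /=.
  rewrite !ffun_catKl !ffun_catKr !ffunE /= big_split_ord /= polyCM.
  under eq_bigr do rewrite !ffunE !(unsplitK (inl _)).
  under [X in _ * X%:P * _ * _ * _ = _]eq_bigr do rewrite !ffunE !(unsplitK (inr _)).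
  ring.
exists (fun s => ((ffun_left s.1.1, ffun_left s.1.2, ffun_left s.2),
  (ffun_right s.1.1, ffun_right s.1.2, ffun_right s.2))).
  by move=> [[[x y] z] [[x' y'] z']] _ /=; rewrite !ffun_catKl !ffun_catKr.
by move=> [[x y] z] _ /=; rewrite !ffun_catK.
Qed.

Lemma eqn_divmod d i j : (i == j) = (i %/ d == j %/ d)%N && (i %% d == j %% d)%N.
Proof.
apply/eqP/andP => [->|[/eqP ij /eqP ij']]; first by rewrite !eqxx.
by rewrite (divn_eq i d) ij ij' -divn_eq.
Qed.

(** The product of <a, b, c> and <a', b', c'> is <aa', bb', cc'>; quotient and remainder by the
    primed dimension decode one number into a pair of indices. *)
Lemma mm_degenerates_prod T m n (I J : finType) (a b c : I -> nat)
    (a' b' c' : J -> nat) :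
  mm_degenerates (tpow T m) a b c -> mm_degenerates (tpow T n) a' b' c' ->
  mm_degenerates (tpow T (m + n)) (fun l : I * J => a l.1 * a' l.2)%N
    (fun l => b l.1 * b' l.2)%N (fun l => c l.1 * c' l.2)%N.
Proof.
move=> [A [B [C [h ABC]]]] [A' [B' [C' [h' ABC']]]].
pose D (V : finType) (d e : J -> nat)
  (G : I -> nat -> nat -> {ffun 'I_m -> V} -> {poly F})
  (G' : J -> nat -> nat -> {ffun 'I_n -> V} -> {poly F}) (l : I * J) i j v :=
  G l.1 (i %/ d l.2)%N (j %/ e l.2)%N (ffun_left v) *
  G' l.2 (i %% d l.2)%N (j %% e l.2)%N (ffun_right v).
exists (D X a' b' A A'), (D Y b' c' B B'), (D Z c' a' C C'), (h + h')%N.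
move=> [l1 l1'] [l2 l2'] [l3 l3'] i1 j1 j2 k2 k3 i3 /= i1a j1b j2b k2c k3c i3a.
rewrite trilin_tpowD.
have pos u v w : (u < v * w)%N -> (0 < w)%N by case: w => //; rewrite muln0.
have Q := ABC l1 l2 l3 (i1 %/ a' l1')%N (j1 %/ b' l1')%N (j2 %/ b' l2')%N (k2 %/ c' l2')%N
  (k3 %/ c' l3')%N (i3 %/ a' l3')%N.
have Q' := ABC' l1' l2' l3' (i1 %% a' l1')%N (j1 %% b' l1')%N (j2 %% b' l2')%N
  (k2 %% c' l2')%N (k3 %% c' l3')%N (i3 %% a' l3')%N.
rewrite !ltn_divLR ?(pos _ _ _ i1a) ?(pos _ _ _ j1b) ?(pos _ _ _ j2b)
  ?(pos _ _ _ k2c) ?(pos _ _ _ k3c) ?(pos _ _ _ i3a) // in Q.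
rewrite !ltn_mod ?(pos _ _ _ i1a) ?(pos _ _ _ j1b) ?(pos _ _ _ j2b)
  ?(pos _ _ _ k2c) ?(pos _ _ _ k3c) ?(pos _ _ _ i3a) // in Q'.
apply: leading_term_eq (leading_termM (Q _ _ _ _ _ _) (Q' _ _ _ _ _ _)) => //.
rewrite -natrM mulnb; congr (_%:R); congr nat_of_bool.
rewrite !xpair_eqE.
have [<-|] := eqVneq l1 l2; last by [].
have [<-|] := eqVneq l1' l2'; last by rewrite !andbF.
have [_|] := eqVneq l1 l3; last by [].
have [<-|] := eqVneq l1' l3'; last by rewrite !andbF.
rewrite (eqn_divmod (a' l1') i1) (eqn_divmod (b' l1') j1) (eqn_divmod (c' l1') k2).
by do !case: (_ == _).
Qed.

End Powers.

(** * Strassen's degeneration to a diagonal tensor *)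

(** The reflection (i, j) -> (q-1-i, q-1-j) maps the complement of the triangle into the
    triangle. *)
Lemma leq_sqr_card_triangle q :
  (q ^ 2 <= 2 * #|[set p : 'I_q * 'I_q | p.1 + p.2 < q]|)%N.
Proof.
set S := [set _ | _].
have -> : (q ^ 2 = #|{: 'I_q * 'I_q}|)%N by rewrite card_prod card_ord mulnn.
rewrite -(cardsC S) mul2n -addnn leq_add2l.
pose f (p : 'I_q * 'I_q) := (rev_ord p.1, rev_ord p.2).
have f_inj : injective f.
  by apply: (@can_inj _ _ f f) => -[i j]; rewrite /f /= !rev_ordK.
rewrite -(card_imset (~: S) f_inj) subset_leq_card //.
apply/fintype.subsetP => _ /imsetP[[i j] + ->]; rewrite !inE /=.
by have := ltn_ord i; have := ltn_ord j; lia.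
Qed.

Section Diagonal.
Variables (F : fieldType) (X Y Z : finType).
Implicit Types (T : tensor F X Y Z).

Lemma trilin_comp_Xn T a b c K u v w :
  trilin T (fun x => (a x \Po 'X^K) * 'X^u) (fun y => (b y \Po 'X^K) * 'X^v)
    (fun z => (c z \Po 'X^K) * 'X^w) = (trilin T a b c \Po 'X^K) * 'X^(u + v + w).
Proof.
rewrite /trilin rmorph_sum mulr_suml; apply: eq_bigr => s _.
by rewrite !rmorphM /= comp_polyC !exprD; ring.
Qed.

(* Strassen: giving x_ij, y_jk, z_ki the weights i^2 + 2ij, j^2 + 2jk, k^2 + 2ki
   corrected by a linear term in the first index, the product x_ij y_jk z_ki has
   weight (i + j + k - g)^2 up to a constant. On i + j + k = g any two of the
   three variables determine the third. *)
Lemma slice_rank_mm T (I : finType) q :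
  mm_degenerates T (fun _ : I => q) (fun=> q) (fun=> q) ->
  (#|I| * q ^ 2 <= 2 * slice_rank T)%N.
Proof.
move=> [A [B [C [h ABC]]]].
pose S := [set p : 'I_q * 'I_q | p.1 + p.2 < q]%N.
pose E : finType := {e : I * ('I_q * 'I_q) | e.2 \in S}.
suff : (#|E| <= slice_rank T)%N.
  have -> : #|E| = (#|I| * #|S|)%N.
    rewrite card_sig -cardX; apply: eq_card => -[l p].
    by rewrite !inE.
  rewrite -(leq_pmul2l (isT : 0 < 2)%N); apply: leq_trans.
  by rewrite mulnCA leq_mul2l leq_sqr_card_triangle orbT.
have Eq (e : E) : ((val e).2.1 + (val e).2.2 < q)%N.
  by have := valP e; rewrite !inE.
(* To stay in [nat], the linear correction -2gi is written 2g(q - i). With s = i + j + k the three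
   weights then add up to (s - g)^2 + 6gq - g^2, and [K] is one more than the minimum. *)
pose g := q.-1; pose K := (6 * g * q - g ^ 2).+1.
pose wt i j := (i ^ 2 + 2 * i * j + 2 * g * (q - i))%N.
pose Ei (e : E) : nat := (val e).2.1; pose Ej (e : E) : nat := (val e).2.2.
pose Ek e := (g - Ei e - Ej e)%N.
have Eij e : (Ei e + Ej e < q)%N by exact: Eq.
apply: (@slice_rank_ge F X Y Z T E
  (fun e x => (A (val e).1 (Ei e) (Ej e) x \Po 'X^K) * 'X^(wt (Ei e) (Ej e)))
  (fun e y => (B (val e).1 (Ej e) (Ek e) y \Po 'X^K) * 'X^(wt (Ej e) (Ek e)))
  (fun e z => (C (val e).1 (Ek e) (Ei e) z \Po 'X^K) * 'X^(wt (Ek e) (Ei e)))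
  (h * K + (6 * g * q - g ^ 2))%N) => e1 e2 e3.
rewrite trilin_comp_Xn.
have H1 := Eij e1; have H2 := Eij e2; have H3 := Eij e3.
have K0 : (0 < K)%N by [].
set W := (_ + _ + _)%N; set p := trilin _ _ _ _.
set d := [&& (val e1).1 == (val e2).1, (val e2).1 == (val e3).1,
  Ei e1 == Ei e3, Ej e1 == Ej e2 & Ek e2 == Ek e3].
have pd : leading_term h d%:R p by apply: ABC; rewrite /Ek /g; lia.
have [/and5P[/eqP l12 /eqP l23 /eqP i13 /eqP j12 /eqP k23]|dF] := boolP d; last first.
  have -> : (e1 == e2) && (e2 == e3) = false.
    by apply: contraNF dF => /andP[/eqP e12 /eqP e23]; rewrite /d e12 e23 !eqxx.
  (* On mismatched indices the coefficient of order [h] vanishes too. The order after stretching is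
     then at least (h + 1)K, already beyond the target order even with weight 0. *)
  have p1 : leading_term h.+1 p`_h.+1 p.
    rewrite (negbTE dF) in pd; case: pd => p0 plt; split=> // m.
    by rewrite ltnS leq_eqVlt => /orP[/eqP->|/plt].
  have := leading_termM (leading_term_comp_Xn K0 p1) (leading_termXn F W).
  by move=> /leading_term_lt; apply; rewrite mulSn /K; lia.
have dT : d by rewrite /d l12 l23 i13 j12 k23 !eqxx.
rewrite dT in pd.
have := leading_termM (leading_term_comp_Xn K0 pd) (leading_termXn F W).
rewrite mulr1 => pW.
have q0 : (0 < q)%N by lia.
have WE : (W + 2 * g * (Ei e1 + Ej e1 + Ek e2) =
    (Ei e1 + Ej e1 + Ek e2) ^ 2 + 6 * g * q)%N.
  rewrite /W /wt -i13 -j12 -k23.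
  have : (Ek e2 <= q)%N by rewrite /Ek /g; lia.
  move: (Ek e2) => k kq.
  have [i' Ei'] : exists i', (q = Ei e1 + i')%N by exists (q - Ei e1)%N; lia.
  have [j' Ej'] : exists j', (q = Ej e1 + j')%N by exists (q - Ej e1)%N; lia.
  have [k' Ek'] : exists k', (q = k + k')%N by exists (q - k)%N; lia.
  rewrite {1}Ei' {1}Ej' {1}Ek' !addKn.
  have -> : (6 * g * q =
      2 * g * (Ei e1 + i') + 2 * g * (Ej e1 + j') + 2 * g * (k + k'))%N.
    by rewrite -Ei' -Ej' -Ek'; ring.
  ring.
have gq : (g ^ 2 <= 6 * g * q)%N by rewrite /g; nia.
have [sg|sg] := eqVneq (Ei e1 + Ej e1 + Ek e2)%N g.
  have i12 : Ei e1 = Ei e2 by move: sg; rewrite j12 /Ek /g; lia.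
  have j13 : Ej e1 = Ej e3 by move: sg; rewrite k23 i13 /Ek /g; lia.
  have e_eq e e' : (val e).1 = (val e').1 -> Ei e = Ei e' -> Ej e = Ej e' -> e = e'.
    move=> le ie je; apply: val_inj; move: le ie je; rewrite /Ei /Ej.
    case: (val e) (val e') => [l [i j]] [l' [i' j']] /= -> /ord_inj -> /ord_inj ->.
    by [].
  have -> : e1 = e2 by exact: e_eq.
  have -> : e2 = e3 by apply: e_eq; rewrite -?i12 -?j12.
  rewrite !eqxx; suff -> : (6 * g * q - g ^ 2 = W)%N by [].
  by rewrite sg in WE; nia.
have -> : (e1 == e2) && (e2 == e3) = false.
  apply: contraNF sg => /andP[/eqP e12 /eqP e23]; apply/eqP; rewrite e12 e23.
  by move: H3; rewrite /Ek /g; lia.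
apply: (leading_term_lt pW); rewrite ltn_add2l.
have sg2 : (2 * g * (Ei e1 + Ej e1 + Ek e2) < (Ei e1 + Ej e1 + Ek e2) ^ 2 + g ^ 2)%N.
  move: (Ei e1 + Ej e1 + Ek e2)%N sg => s sg.
  by rewrite -mulnA [(g * s)%N]mulnC (ltn_leqif (nat_Cauchy s g)).
lia.
Qed.

End Diagonal.

(** * Powers of a degeneration *)

Section TypeClasses.
Variables (I : finType) (N : nat).

(** A letter occurs at most N times, so [inord] truncates nothing; the finite codomain bounds the
    number of types by (N + 1)^#|I|. *)
Definition word_type (w : {ffun 'I_N -> I}) : {ffun I -> 'I_N.+1} :=
  [ffun i => inord #|[pred t | w t == i]|].

Lemma prod_word_type (f : I -> nat) (w : {ffun 'I_N -> I}) :
  (\prod_t f (w t) = \prod_i f i ^ word_type w i)%N.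
Proof.
rewrite (partition_big w predT) //=; apply: eq_bigr => i _.
rewrite ffunE inordK; last by rewrite ltnS -[leqRHS](card_ord N) max_card.
under eq_bigr => t /eqP -> do [].
by rewrite prod_nat_const.
Qed.

End TypeClasses.

Section Unit.
Variables (F : fieldType) (X Y Z : finType) (T : tensor F X Y Z).

Lemma mm_degenerates_unit s : T s != 0 ->
  mm_degenerates T (fun _ : unit => 1%N) (fun=> 1%N) (fun=> 1%N).
Proof.
move=> Ts0.
exists (fun _ _ _ x => (x == s.1.1)%:R * (T s)^-1%:P), (fun _ _ _ y => (y == s.1.2)%:R).
exists (fun _ _ _ z => (z == s.2)%:R), 0%N.
move=> [] [] [] [|//] [|//] [|//] [|//] [|//] [|//] _ _ _ _ _ _.
rewrite /trilin (bigD1 s) //= !eqxx !mulr1 mul1r -polyCM divff // big1 ?addr0.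
  by split=> //; rewrite coef1.
case: s Ts0 => [[x y] z] _ [[x' y'] z']; rewrite !xpair_eqE /=.
by case: (x' == x); case: (y' == y); case: (z' == z) => //;
  rewrite ?(mul0r, mulr0).
Qed.

End Unit.

Section PowersOfDegenerations.
Variables (F : fieldType) (X Y Z : finType) (T : tensor F X Y Z).
Variable s : X * Y * Z.
Hypothesis Ts0 : T s != 0.

Lemma mm_degenerates_tpow_unit n :
  mm_degenerates (tpow T n) (fun _ : unit => 1%N) (fun=> 1%N) (fun=> 1%N).
Proof.
apply: (@mm_degenerates_unit _ _ _ _ _ ([ffun=> s.1.1], [ffun=> s.1.2], [ffun=> s.2])).
rewrite ffunE /=; under eq_bigr do rewrite !ffunE -!surjective_pairing.
by rewrite prodr_const expf_neq0.
Qed.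

(** Tensoring with <1, 1, 1> keeps all dimensions. This reaches the exponents that are not multiples
    of 3n. *)
Lemma mm_degenerates_pad n r (I : finType) (a b c : I -> nat) :
  mm_degenerates (tpow T n) a b c -> mm_degenerates (tpow T (n + r)) a b c.
Proof.
move=> /mm_degenerates_prod /(_ (mm_degenerates_tpow_unit r)).
move=> /(@mm_degenerates_inj _ _ _ _ _ _ _ (fun l => (l, tt))) H.
by apply: eq_mm_degenerates (H _) => [l|l|l|l l' []//] /=; rewrite muln1.
Qed.

Lemma mm_degenerates_pow n N (I : finType) (a b c : I -> nat) :
  mm_degenerates (tpow T n) a b c ->
  mm_degenerates (tpow T (n * N)) (fun w : {ffun 'I_N -> I} => \prod_t a (w t))%N
    (fun w => \prod_t b (w t))%N (fun w => \prod_t c (w t))%N.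
Proof.
move=> Tabc; elim: N => [|N IH].
  rewrite muln0; have f_inj : injective (fun _ : {ffun 'I_0 -> I} => tt).
    by move=> u v _; apply/ffunP => -[].
  have := mm_degenerates_inj f_inj (mm_degenerates_tpow_unit 0).
  by apply: eq_mm_degenerates => w /=; rewrite big_ord0.
pose f (w : {ffun 'I_N.+1 -> I}) := (w ord0, [ffun t => w (lift ord0 t)]).
have f_inj : injective f.
  move=> u v [uv0 /ffunP uv]; apply/ffunP => t; case: (unliftP ord0 t) => [t'|] -> //.
  by have := uv t'; rewrite !ffunE.
rewrite mulnS; have := mm_degenerates_inj f_inj (mm_degenerates_prod Tabc IH).
apply: eq_mm_degenerates => w /=; rewrite big_ord_recl; congr (_ * _)%N;
  by apply: eq_bigr => t _; rewrite ffunE.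
Qed.

(* On a type class the three dimensions are constant, say A, B, C. Multiplying by
   the two rotations gives copies of <ABC, ABC, ABC>. *)
Lemma slice_rank_type_class n N r (I : finType) (a b c : I -> nat)
    (tau : {ffun I -> 'I_N.+1}) :
  rotation_symmetric T -> mm_degenerates (tpow T n) a b c ->
  (#|[pred w : {ffun 'I_N -> I} | word_type w == tau]| ^ 3 *
     (\prod_i (a i * b i * c i) ^ tau i) ^ 2
   <= 2 * slice_rank (tpow T (n * N + (n * N + n * N) + r)))%N.
Proof.
move=> Trot /(mm_degenerates_pow N) Tabc.
pose J : finType := {w : {ffun 'I_N -> I} | word_type w == tau}.
pose A := (\prod_i a i ^ tau i)%N; pose B := (\prod_i b i ^ tau i)%N.
pose C := (\prod_i c i ^ tau i)%N.
have TABC : mm_degenerates (tpow T (n * N)) (fun _ : J => A) (fun=> B) (fun=> C).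
  apply: eq_mm_degenerates (mm_degenerates_inj (@val_inj _ _ J) Tabc) => -[w wt] /=;
    by rewrite prod_word_type (eqP wt).
have Tnrot := rotation_symmetric_tpow (n * N) Trot.
have TBCA := mm_degenerates_rotate Tnrot TABC.
have TCAB := mm_degenerates_rotate Tnrot TBCA.
have Tq : mm_degenerates (tpow T (n * N + (n * N + n * N)))
    (fun _ : J * (J * J) => A * B * C)%N (fun=> A * B * C)%N (fun=> A * B * C)%N.
  by apply: eq_mm_degenerates
    (mm_degenerates_prod TABC (mm_degenerates_prod TBCA TCAB)) => l /=; ring.
have := slice_rank_mm (mm_degenerates_pad r Tq).
rewrite !card_prod card_sig /A /B /C -!big_split /=.
under eq_bigr do rewrite -!expnMn.
by rewrite (expnS _ 2) -(mulnn #|_|).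
Qed.

End PowersOfDegenerations.

(** * Real inequalities *)

Section RealBounds.
Variable R : realType.

Lemma ltr_powR (a x y : R) : 1 < a -> x < y -> a `^ x < a `^ y.
Proof.
move=> a1 xy; have a0 : 0 < a by apply: lt_trans a1.
by rewrite /powR gt_eqF // ltr_expR ltr_pM2r // ln_gt0.
Qed.

Lemma powR_exprn_inv (a : R) n : 0 <= a -> (0 < n)%N -> (a ^+ n) `^ n%:R^-1 = a.
Proof.
by move=> a0 n0; rewrite -powR_mulrn // -powRrM divff ?powRr1 // pnatr_eq0 -lt0n.
Qed.

Lemma powR_prod (J : finType) (f : J -> R) x : (forall j, 0 <= f j) ->
  (\prod_j f j) `^ x = \prod_j f j `^ x.
Proof.
move=> f0; elim: (index_enum J) => [|j r IH]; first by rewrite !big_nil powR1.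
by rewrite !big_cons powRM ?prodr_ge0 // IH.
Qed.

(** Each f_j^x = f_j f_j^(x-1) is at most f_j times the (x-1)-th power of the whole sum. *)
Lemma sum_powR_le (J : finType) (f : J -> R) x : 1 <= x -> (forall j, 0 <= f j) ->
  \sum_j f j `^ x <= (\sum_j f j) `^ x.
Proof.
move=> x1 f0; have x0 : 0 < x by apply: lt_le_trans x1.
rewrite -[leRHS]mulr_powRB1 ?sumr_ge0 // mulr_suml; apply: ler_sum => j _.
rewrite -mulr_powRB1 // ler_wpM2l // ge0_ler_powR ?subr_ge0 ?nnegrE ?sumr_ge0 //.
by rewrite (bigD1 j) //= lerDl sumr_ge0.
Qed.

(** With rho = mu^2, one factor mu^N absorbs the new N + 1 and the other is left to the induction
    hypothesis. *)
Lemma natX_le_geometric (rho : R) k : 1 < rho ->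
  exists C, forall N, N.+1%:R ^+ k <= C * rho ^+ N.
Proof.
elim: k rho => [|k IH] rho rho1.
  by exists 1 => N; rewrite expr0 mul1r exprn_ege1 // ltW.
pose mu := Num.sqrt rho; have mu1 : 1 < mu by rewrite -[ltLHS]sqrtr1 ltr_sqrt //; lra.
have mu_rho : mu * mu = rho by rewrite -expr2 sqr_sqrtr //; lra.
have [C CN] := IH _ mu1.
(* Since D (mu - 1) = mu >= 1, the sequence D mu^N grows by at least 1 at each step. *)
pose D := 1 + (mu - 1)^-1.
have D0 : 0 <= (mu - 1)^-1 by rewrite invr_ge0 subr_ge0 ltW.
have DN N : N.+1%:R <= D * mu ^+ N.
  elim: N => [|N IHN]; first by rewrite expr0 /D; lra.
  have muN : 1 <= mu ^+ N by rewrite exprn_ege1 // ltW.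
  rewrite -[N.+2]addn1 natrD exprS.
  have -> : D * (mu * mu ^+ N) = D * mu ^+ N + (D * (mu - 1)) * mu ^+ N by ring.
  apply: lerD => //; rewrite -[leLHS]mulr1 ler_pM //.
  by rewrite /D mulrDl mulVf; [lra|lra].
exists (D * C) => N; rewrite exprS -mu_rho exprMn mulrACA.
by rewrite ler_pM // exprn_ge0.
Qed.

(** The bound for exponent k + 1 has a spare factor N + 1, which eventually exceeds any constant. *)
Lemma natX_eventually_le_geometric (rho C : R) k : 1 < rho ->
  exists N0, forall N, (N0 <= N)%N -> C * N.+1%:R ^+ k <= rho ^+ N.
Proof.
move=> rho1; have [D DN] := natX_le_geometric k.+1 rho1.
have D0 : 0 < D by have := DN 0%N; rewrite expr1n expr0 mulr1; lra.
exists (Num.Def.trunc (`|C| * D)) => N N0N.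
have CD : `|C| * D <= N.+1%:R.
  by rewrite (le_trans (ltW (truncnS_gt _))) // ler_nat ltnS.
rewrite -(ler_pM2l D0); apply: le_trans (DN N).
rewrite exprS mulrA ler_wpM2r ?exprn_ge0 //; apply: le_trans CD.
by rewrite mulrC ler_wpM2r ?ler_norm // ltW.
Qed.

Lemma limn_sup_inf_ge (u : R^nat) s N0 B :
  (forall n, 0 <= u n <= B) -> (forall n, (N0 <= n)%N -> s <= u n) ->
  s <= limn_sup u /\ s <= limn_inf u.
Proof.
move=> uB su.
have ub : bounded_fun (u : R^o^nat).
  exists B; split; first exact: num_real.
  move=> M BM n _ /=; case/andP: (uB n) => u0 uB'.
  by rewrite ger0_norm // (le_trans uB') // ltW.
split.
  rewrite limn_supE //; apply: lb_le_inf; first by exists (sups u 0%N), 0%N.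
  move=> _ [n _ <-]; apply: (le_trans (su (maxn N0 n) (leq_maxl _ _))).
  apply: ub_le_sup; last by exists (maxn N0 n) => //=; exact: leq_maxr.
  exact/has_ubound_sdrop/bounded_fun_has_ubound.
rewrite limn_infE //; apply: (@le_trans _ _ (infs u N0)).
  apply: lb_le_inf; first by exists (u N0), N0 => /=.
  by move=> _ [n /= N0n <-]; exact: su.
by apply: ub_le_sup; [exact: bounded_fun_has_ubound_infs|exists N0].
Qed.

End RealBounds.

(** * Asymptotics *)

Section LargeTypeClass.
Variables (R : realType) (I : finType) (p : I -> nat).

Lemma large_type_class N : exists tau : {ffun I -> 'I_N.+1},
  (\sum_i (p i)%:R `^ (2 / 3)) ^+ N <= N.+1%:R ^+ #|I| *
    (#|[pred w : {ffun 'I_N -> I} | word_type w == tau]|%:R *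
     (\prod_i p i ^ tau i)%:R `^ (2 / 3)) :> R.
Proof.
set sigma := \sum_i _.
pose x (tau : {ffun I -> 'I_N.+1}) : R :=
  #|[pred w : {ffun 'I_N -> I} | word_type w == tau]|%:R *
  (\prod_i p i ^ tau i)%:R `^ (2 / 3).
have sigmaE : sigma ^+ N = \sum_tau x tau.
  have -> : sigma ^+ N = \prod_(t < N) sigma by rewrite prodr_const card_ord.
  rewrite /sigma bigA_distr_bigA /= (partition_big (@word_type I N) predT) //=.
  apply: eq_bigr => tau _; rewrite /x -sum1_card natr_sum mulr_suml.
  apply: eq_bigr => w /eqP <-; rewrite mul1r -prod_word_type natr_prod.
  by rewrite powR_prod.
have cardE : N.+1%:R ^+ #|I| = #|{ffun I -> 'I_N.+1}|%:R :> R.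
  by rewrite card_ffun card_ord natrX.
apply/not_existsP => xlt.
suff : \sum_(tau : {ffun I -> 'I_N.+1}) (N.+1%:R ^+ #|I| * x tau) <
       \sum_(tau : {ffun I -> 'I_N.+1}) sigma ^+ N.
  by rewrite -mulr_sumr -sigmaE sumr_const -[ltRHS]mulr_natl cardE ltxx.
apply: ltr_sum => [|tau _]; last by rewrite ltNge; apply/negP/xlt.
by apply/hasP; exists [ffun=> ord0]; rewrite ?mem_index_enum.
Qed.

End LargeTypeClass.

Section Asymptotics.
Variables (R : realType) (F : fieldType) (X Y Z : finType) (T : tensor F X Y Z).
Variables (s : X * Y * Z) (Ts0 : T s != 0) (Trot : rotation_symmetric T).
Variables (n : nat) (I : finType) (a b c : I -> nat).
Hypotheses (n_gt0 : (0 < n)%N) (Tabc : mm_degenerates (tpow T n) a b c).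
Let sigma : R := \sum_i (a i * b i * c i)%:R `^ (2 / 3).

(** Cubing [large_type_class] turns D P^(2/3) into D^3 P^2, the quantity bounded in
    [slice_rank_type_class]. *)
Lemma sigma_pow_le_slice_rank N r :
  (sigma ^+ 3) ^+ N <= N.+1%:R ^+ (#|I| * 3) *
    (2 * (slice_rank (tpow T (n * N + (n * N + n * N) + r)))%:R).
Proof.
have [tau] := large_type_class R (fun i => a i * b i * c i)%N N.
rewrite -/sigma => /(lerXn2r 3); rewrite !nnegrE.
have sigma0 : 0 <= sigma by rewrite sumr_ge0 // => i _; exact: powR_ge0.
move=> /(_ (exprn_ge0 _ sigma0)) /(_ _)/wrap[]; first by rewrite !mulr_ge0 // powR_ge0.
rewrite -exprM mulnC exprM => /le_trans; apply.
rewrite exprMn -exprM ler_wpM2l ?exprn_ge0 // exprMn -[X in _ * X]powR_mulrn ?powR_ge0 //.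
rewrite -powRrM mulfVK // powR_mulrn // -!natrX -!natrM ler_nat.
exact: (slice_rank_type_class Ts0).
Qed.

(** The strict gap between x^n and sigma yields a geometric factor that absorbs the polynomial
    number of types and all constants. *)
Lemma slice_rank_tpow_ge x : 0 < x -> x ^+ n < sigma ->
  exists M0, forall M, (M0 <= M)%N -> x ^+ M <= (slice_rank (tpow T M))%:R.
Proof.
move=> x0 xn.
have xn0 : 0 < x ^+ n by rewrite exprn_gt0.
pose rho := (sigma / x ^+ n) ^+ 3.
have rho1 : 1 < rho by rewrite exprn_egt1 // ltr_pdivlMr // mul1r.
(* The power of 1 + x bounds x^r for the remainder r < 3n, whether or not x exceeds 1. *)
pose C := 2 * (1 + x) ^+ (n * 3).
have [N0 N0P] := natX_eventually_le_geometric C (#|I| * 3) rho1.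
exists (N0 * (n * 3))%N => M M0M.
have d0 : (0 < n * 3)%N by rewrite muln_gt0 n_gt0.
set N := (M %/ (n * 3))%N; set r := (M %% (n * 3))%N.
have ME : M = (n * N + (n * N + n * N) + r)%N.
  by rewrite {1}(divn_eq M (n * 3)) -/N -/r; ring.
have N0N : (N0 <= N)%N by rewrite leq_divRL.
have := N0P N N0N; have := sigma_pow_le_slice_rank N r; rewrite -ME.
set S := (slice_rank _)%:R => sigmaS rhoN.
have xM : x ^+ M <= ((x ^+ n) ^+ 3) ^+ N * (1 + x) ^+ (n * 3).
  have -> : x ^+ M = ((x ^+ n) ^+ 3) ^+ N * x ^+ r.
    by rewrite -!exprM -exprD; congr (x ^+ _); rewrite ME; ring.
  rewrite ler_wpM2l ?exprn_ge0 ?(ltW x0) ?(ltW xn0) //.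
  apply: (@le_trans _ _ ((1 + x) ^+ r)); first by apply: lerXn2r; rewrite ?nnegrE; lra.
  by rewrite ler_weXn2l ?lerDl ?(ltW x0) // ltnW // ltn_mod.
have P0 : 0 < N.+1%:R ^+ (#|I| * 3) :> R by rewrite exprn_gt0.
apply: (le_trans xM); rewrite -(ler_pM2l P0) -(ler_pM2l (ltr0Sn R 1)).
apply: (@le_trans _ _ (((x ^+ n) ^+ 3) ^+ N * rho ^+ N)).
  rewrite [leLHS](_ : _ = ((x ^+ n) ^+ 3) ^+ N * (C * N.+1%:R ^+ (#|I| * 3))).
    by rewrite ler_wpM2l // !exprn_ge0 // ltW.
  by rewrite /C; ring.
rewrite -exprMn /rho -exprMn mulrC divfK ?gt_eqF //.
by apply: (le_trans sigmaS); rewrite [leLHS]mulrCA.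
Qed.

Lemma rank_root_bounds (M : nat) :
  0 <= ((rank (tpow T M))%:R : R) `^ M%:R^-1 <=
    (1 + (#|X| * #|Y| * #|Z|)%:R : R).
Proof.
(* At M = 0 the exponent 0^-1 is 0 and the root is 1, which the summand 1 of the bound covers. *)
rewrite powR_ge0 /=; case: M => [|M].
  by rewrite invr0 powRr0 lerDl.
apply: (@le_trans _ _ (#|X| * #|Y| * #|Z|)%:R); last by rewrite lerDr.
rewrite -[leRHS](@powR_exprn_inv _ _ M.+1) //.
apply: ge0_ler_powR; rewrite ?nnegrE ?exprn_ge0 // -natrX ler_nat.
by rewrite (leq_trans (rank_le_card _)) // !card_ffun card_ord -!expnMn.
Qed.

Lemma asymptotic_ranks_ge x : 0 < x -> x ^+ n < sigma ->
  x <= asymptotic_slice_rank R T /\ x <= asymptotic_rank R T.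
Proof.
move=> x0 xn; have [M0 M0P] := slice_rank_tpow_ge x0 xn.
have Sx M : (maxn M0 1 <= M)%N -> x <= (slice_rank (tpow T M))%:R `^ M%:R^-1 :> R.
  rewrite geq_max => /andP[/M0P xM M1].
  rewrite -[leLHS](@powR_exprn_inv _ _ M) ?(ltW x0) //.
  by apply: ge0_ler_powR; rewrite ?invr_ge0 ?nnegrE ?exprn_ge0 // ltW.
have SR M : (slice_rank (tpow T M))%:R `^ M%:R^-1 <=
    (rank (tpow T M))%:R `^ M%:R^-1 :> R.
  by apply: ge0_ler_powR; rewrite ?invr_ge0 ?nnegrE // ler_nat slice_rank_le_rank.
have SB M : 0 <= ((slice_rank (tpow T M))%:R : R) `^ M%:R^-1 <=
    1 + (#|X| * #|Y| * #|Z|)%:R.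
  by rewrite powR_ge0 (le_trans (SR M)) //; case/andP: (rank_root_bounds M).
have RM M : (maxn M0 1 <= M)%N -> x <= (rank (tpow T M))%:R `^ M%:R^-1 :> R.
  by move=> /Sx /le_trans; apply.
split; first exact: (proj1 (limn_sup_inf_ge SB Sx)).
exact: (proj2 (limn_sup_inf_ge rank_root_bounds RM)).
Qed.

Lemma asymptotic_ranks_ge_root : 0 < sigma ->
  sigma `^ n%:R^-1 <= asymptotic_slice_rank R T /\
  sigma `^ n%:R^-1 <= asymptotic_rank R T.
Proof.
move=> sigma0; set theta := sigma `^ _.
have theta0 : 0 < theta by rewrite powR_gt0.
have xtheta x : 0 < x -> x < theta -> x ^+ n < sigma.
  move=> x0 xt; rewrite -powR_mulrn ?ltW //.
  have -> : sigma = theta `^ n%:R.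
    by rewrite -powRrM mulVf ?powRr1 ?(ltW sigma0) // pnatr_eq0 -lt0n.
  by apply: gt0_ltr_powR; rewrite ?ltr0n ?nnegrE // ltW.
have approx y : (forall x, 0 < x -> x < theta -> x <= y) -> theta <= y.
  move=> xy; rewrite leNgt; apply/negP => yt.
  have y0 : 0 < y by apply: lt_le_trans (xy (theta / 2) _ _); lra.
  by have := xy ((y + theta) / 2); lra.
by split; apply: approx => x x0 /(xtheta _ x0) /(asymptotic_ranks_ge x0) [].
Qed.

End Asymptotics.

(** * Nonvanishing of the tensor and the bound on [omega_u] *)

Lemma mm_degenerates_neq0 (F : fieldType) (X Y Z : finType) (T : tensor F X Y Z)
    (I : finType) (a b c : I -> nat) l :
  mm_degenerates T a b c -> (0 < a l)%N -> (0 < b l)%N -> (0 < c l)%N ->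
  exists s, T s != 0.
Proof.
move=> [A [B [C [h ABC]]]] al bl cl.
case: (pickP (fun s => T s != 0)) => [s Ts|T0]; first by exists s.
have [/eqP + _] := ABC l l l _ _ _ _ _ _ al bl bl cl cl al.
rewrite !eqxx /trilin big1 ?coef0 1?eq_sym ?oner_eq0 // => s _.
by have /negPn/eqP -> := negbT (T0 s); rewrite !mul0r.
Qed.

(** Positivity of [n] matters: the 0-th power is an empty product, equal to 1 even for T = 0. *)
Lemma tpow_neq0 (F : fieldType) (X Y Z : finType) (T : tensor F X Y Z) n s :
  (0 < n)%N -> tpow T n s != 0 -> exists s', T s' != 0.
Proof.
case: n s => // n s _; rewrite ffunE => /prodf_neq0 Ts.
by exists (s.1.1 ord0, s.1.2 ord0, s.2 ord0); apply: Ts.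
Qed.

Theorem theorem3p9 (R : realType) (F : fieldType) (X Y Z : finType)
    (T : tensor F X Y Z) (hT : variable_symmetric T) :
  ((2 * ln (asymptotic_rank R T) / ln (asymptotic_slice_rank R T))%:E
     <= omega_u R T)%E.
Proof.
apply: le_ereal_inf_tmp => _ [w [n [m [a [b [c [n0 abc0 [i1 abc1] Tdeg wE]]]]]] <-].
rewrite lee_fin; have Tabc := degenerates_mm Tdeg.
have [a1 b1 c1] := abc0 i1.
have [s' Ts'] := mm_degenerates_neq0 Tabc a1 b1 c1.
have [s Ts] := tpow_neq0 n0 Ts'.
pose p i : R := (a i * b i * c i)%:R.
have p_ge1 i : 1 <= p i by rewrite /p ler1n !muln_gt0; case: (abc0 i) => -> -> ->.
have p1 : 1 < p i1 by rewrite /p ltr1n.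
pose sigma := \sum_i p i `^ (2 / 3).
have sigma1 : 1 < sigma.
  rewrite /sigma (bigD1 i1) //=.
  have : 1 < p i1 `^ (2 / 3) by rewrite -[ltLHS](powRr0 (p i1)) ltr_powR.
  have : 0 <= \sum_(i < m | i != i1) p i `^ (2 / 3).
    by apply: sumr_ge0 => i _; exact: powR_ge0.
  lra.
have sigma0 : 0 < sigma by lra.
have [] := asymptotic_ranks_ge_root Ts (variable_symmetric_rotation hT) n0 Tabc sigma0.
move: wE; set RT := asymptotic_rank R T; set ST := asymptotic_slice_rank R T.
rewrite -/sigma; set theta := sigma `^ _ => wE thetaS thetaR.
have theta1 : 1 < theta by rewrite -[ltLHS](powRr0 sigma) ltr_powR // invr_gt0 ltr0n.
have thetaE : theta ^+ n = sigma.
  rewrite -powR_mulrn ?powR_ge0 // -powRrM mulVf ?powRr1 ?(ltW sigma0) //.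
  by rewrite pnatr_eq0 -lt0n.
have {}wE : \sum_i p i `^ (w / 3) = RT ^+ n by [].
have theta0 : 0 < theta by apply: lt_trans theta1.
have R0 : 0 < RT := lt_le_trans theta0 thetaR.
have S1 : 1 < ST := lt_le_trans theta1 thetaS.
have S0 : 0 < ST := lt_le_trans theta0 thetaS.
(* The summand [i1] makes the sum strictly increasing in w, so w < 2 would give R~^n < sigma =
   theta^n <= R~^n. *)
have [w2|w2] := ltP w 2.
  suff : RT ^+ n < sigma.
    have : theta ^+ n <= RT ^+ n.
      by apply: lerXn2r; rewrite ?nnegrE ?(ltW theta0) ?(ltW R0).
    by rewrite thetaE => /le_lt_trans H /H; rewrite ltxx.
  rewrite -wE /sigma (bigD1 i1) //= [ltRHS](bigD1 i1) //=; apply: ltr_leD.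
    by rewrite ltr_powR //; lra.
  by apply: ler_sum => i _; rewrite ler_powR //; lra.
have RS : RT ^+ n <= (ST ^+ n) `^ (w / 2).
  rewrite -wE; apply: (@le_trans _ _ (sigma `^ (w / 2))).
    rewrite [leLHS](_ : _ = \sum_i (p i `^ (2 / 3)) `^ (w / 2)).
      by apply: sum_powR_le => [|i]; [lra|exact: powR_ge0].
    by apply: eq_bigr => i _; rewrite -powRrM; congr (_ `^ _); field.
  apply: ge0_ler_powR; rewrite ?nnegrE ?exprn_ge0 //; try lra.
  by rewrite -thetaE; apply: lerXn2r; rewrite ?nnegrE ?(ltW theta0) ?(ltW S0).
have lnS : 0 < ln ST by rewrite ln_gt0.
rewrite ler_pdivrMr //.
have : ln (RT ^+ n) <= ln ((ST ^+ n) `^ (w / 2)).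
  by rewrite ler_ln // posrE ?powR_gt0 // exprn_gt0.
(* The logarithms read n ln R~ <= (w/2) n ln S~, and the positive factor n cancels. *)
rewrite ln_powR !lnXn // -(mulr_natl (ln RT)) -(mulr_natl (ln ST)) mulrCA.
by rewrite ler_pM2l ?ltr0n //; lra.
Qed.
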